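(* Let $\mathcal{H}$ be a real Hilbert space and $M:\mathcal{H}\to\mathcal{H}$ a monotone and continuous operator with $\mathrm{Zer}\,M\neq\emptyset$. Let $t_0>0$, $\alpha>0$, $x_0\in\mathcal{H}$, and let $x:[t_0,+\infty)\to\mathcal{H}$ be the trajectory solution of the dynamical system $$\dot x(t)+M(x(t))+\frac{\alpha}{t}\,x(t)=0,\qquad x(t_0)=x_0 .$$ Then the following statements are true: (i) as $t\to+\infty$ it holds $\|\dot x(t)\|=\mathcal{O}\left(\frac{1}{t^{\min\{\alpha,1\}}}\right)$ and $\|M(x(t))\|=\mathcal{O}\left(\frac{1}{t^{\min\{\alpha,1\}}}\right)$; (ii) $x(t)$ converges strongly to the minimum norm solution $\xi_*:=P_{\mathrm{Zer}\,M}(0)$ as $t\to+\infty$.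
   Context: $M$ is monotone if $\langle M(x)-M(y),x-y\rangle\ge 0$ for all $x,y\in\mathcal{H}$. $\mathrm{Zer}\,M:=\{x\in\mathcal{H}: M(x)=0\}$, which is closed and convex; $P_{\mathrm{Zer}\,M}$ is the metric projection onto it. It is assumed that the system admits a unique strong global solution, i.e. a function $x:[t_0,+\infty)\to\mathcal{H}$ that is absolutely continuous on every compact interval $[t_0,T]$, satisfies the equation almost everywhere and the initial condition, and for which moreover $t\mapsto M(x(t))$ is absolutely continuous on every compact interval $[t_0,T]$; this is ''the trajectory solution''. Estimates involving $\dot x(t)$ are understood for almost every $t$. *)

(* Defs.v *)
From HB Require Import structures.
From mathcomp Require Import all_boot all_order all_algebra.
From mathcomp Require Import all_classical all_reals all_analysis.
From mathcomp Require Import ring lra.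

Set Implicit Arguments.
Unset Strict Implicit.
Unset Printing Implicit Defensive.

Import Order.TTheory GRing.Theory Num.Theory.
Import numFieldNormedType.Exports.

Local Open Scope ring_scope.
Local Open Scope classical_set_scope.

Section Operator.
Variables (R : realType) (H : normedModType R) (dot : {dot H for idfun}).
Implicit Types (M : H -> H) (C : set H).

Definition monotone_operator M :=
  forall x y : H, 0 <= dot (M x - M y) (x - y).

Definition Zer M : set H := [set x | M x = 0].

Definition is_metric_projection C (u p : H) :=
  C p /\ forall y, C y -> `|u - p| <= `|u - y|.

(* Meaningful when u has a best approximation in C; [metric_projectionP] and
   [metric_projection_unique] give the case of a nonempty closed convex set,
   and [metric_projection_ZerP] that of the zeros of a monotone continuous
   operator in a Hilbert space. *)
Definition metric_projection C (u : H) : H :=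
  get (is_metric_projection C u).

End Operator.

Section StrongSolution.
Variables (R : realType) (H : normedModType R).

(* The intervals [u i, v i] may share endpoints only. *)
Definition absolutely_continuous_on (a b : R) (f : R -> H) :=
  forall e : R, 0 < e -> exists2 d : R, 0 < d &
  forall (n : nat) (u v : 'I_n -> R),
    (forall i, [/\ a <= u i, u i <= v i & v i <= b]) ->
    (forall i j, i != j -> v i <= u j \/ v j <= u i) ->
    \sum_(i < n) (v i - u i) < d ->
    \sum_(i < n) `|f (v i) - f (u i)| < e.

(* Functions on [t0, +oo[ are represented by functions on R, of which only the
   restriction to [t0, +oo[ is constrained; the equation is required at almost
   every t > t0, where the two-sided derivative depends on that restriction
   only. *)
Definition strong_global_solution (M : H -> H) (alpha t0 : R) (x0 : H)
    (x : R -> H) :=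
  [/\ forall T, t0 <= T -> absolutely_continuous_on t0 T x,
      forall T, t0 <= T -> absolutely_continuous_on t0 T (fun t => M (x t)),
      {ae @lebesgue_measure R, forall t, t0 < t ->
        derivable x t 1 /\ 'D_1 x t + M (x t) + (alpha / t) *: x t = 0} &
      x t0 = x0].

Definition trajectory_solution (M : H -> H) (alpha t0 : R) (x0 : H)
    (x : R -> H) :=
  strong_global_solution M alpha t0 x0 x /\
  forall y, strong_global_solution M alpha t0 x0 y ->
    forall t, t0 <= t -> y t = x t.

End StrongSolution.

(* "for almost every t, as t --> +oo" *)
Definition ae_pinfty (R : realType) : set_system R :=
  [set A | exists T : R, {ae @lebesgue_measure R, forall t, T <= t -> A t}].
Arguments ae_pinfty R : clear implicits.

#[global] Instance ae_pinfty_filter (R : realType) : Filter (ae_pinfty R).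
Proof.
have aeF := ae_filter_ringOfSetsType (@lebesgue_measure R).
split.
- by exists 0; apply: (@filterE _ _ aeF).
- move=> A B [S AS] [T BT]; exists (Num.max S T).
  apply: (@filterS2 _ _ aeF _ _ _ _ AS BT) => t At Bt.
  by rewrite ge_max => /andP[St Tt]; split; [exact: At|exact: Bt].
- move=> A B AB [T AT]; exists T.
  by apply: (@filterS _ _ aeF _ _ _ AT) => t At /At /AB.
Qed.

(* The notation f =O_F g takes F in [filter_on]. *)
Canonical ae_pinfty_filter_on (R : realType) :=
  FilterType (ae_pinfty R) (ae_pinfty_filter R).
Canonical pinfty_nbhs_filter_on (R : numFieldType) :=
  FilterType (pinfty_nbhs R) _.

Section MetricProjection.
Variables (R : realType) (H : completeNormedModType R).
Variables (dot : {dot H for idfun}).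
Hypothesis dotE : forall u : H, dot u u = `|u| ^+ 2.

Lemma dot_parallelogram (a b : H) :
  `|a - b| ^+ 2 = 2 * `|a| ^+ 2 + 2 * `|b| ^+ 2 - `|a + b| ^+ 2.
Proof.
rewrite -!dotE !(linearDl, linearDr, linearNl, linearNr) /=; lra.
Qed.

Lemma metric_projection_unique (C : set H) (u p q : H) :
  (forall x y, C x -> C y -> C (2^-1 *: (x + y))) ->
  is_metric_projection C u p -> is_metric_projection C u q -> p = q.
Proof.
move=> Cmid [Cp pmin] [Cq qmin].
have upq : `|u - p| = `|u - q| by apply/le_anti; rewrite pmin//= qmin.
have := dot_parallelogram (u - p) (u - q).
have -> : u - p + (u - q) = 2%:R *: (u - 2^-1 *: (p + q)).
  by rewrite scalerBr scalerA divff// scale1r scaler_nat mulr2n opprD addrACA.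
rewrite normrZ normr_nat exprMn.
have -> : u - p - (u - q) = q - p by rewrite opprB addrC addrA subrK.
have := pmin _ (Cmid _ _ Cp Cq); rewrite -ler_sqr ?nnegrE// -upq => h1 h2.
have : `|q - p| ^+ 2 <= 0 by lra.
by rewrite real_exprn_even_le0 ?normr_real//= normr_eq0 subr_eq0 => /eqP.
Qed.

Lemma metric_projectionP (C : set H) (u : H) :
  closed C -> (forall x y, C x -> C y -> C (2^-1 *: (x + y))) -> C !=set0 ->
  is_metric_projection C u (metric_projection C u).
Proof.
move=> Ccl Cmid [c0 Cc0].
suff [p pP] : exists p, is_metric_projection C u p by by apply: getPex; exists p.
pose E := [set `|u - p| ^+ 2 | p in C].
have Elb : has_lbound E by exists 0 => _ [p _ <-]; exact: sqr_ge0.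
have Einf : has_inf E by split => //; exists (`|u - c0| ^+ 2), c0.
pose d := inf E.
have dle p : C p -> d <= `|u - p| ^+ 2 by move=> Cp; apply: ge_inf => //; exists p.
have /choice[p pP] (n : nat) : exists p, C p /\ `|u - p| ^+ 2 < d + n.+1%:R^-1.
  have [//|_ [p Cp <-] lt] := @inf_adherent _ E n.+1%:R^-1 _ Einf.
  by exists p.
have dist n m : `|p n - p m| ^+ 2 <= 2 * n.+1%:R^-1 + 2 * m.+1%:R^-1.
  have [Cn ln] := pP n; have [Cm lm] := pP m.
  have := dot_parallelogram (u - p n) (u - p m).
  have -> : u - p n + (u - p m) = 2%:R *: (u - 2^-1 *: (p n + p m)).
    by rewrite scalerBr scalerA divff// scale1r scaler_nat mulr2n opprD addrACA.
  rewrite normrZ normr_nat exprMn.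
  have -> : u - p n - (u - p m) = - (p n - p m).
    by rewrite !opprB addrC addrA subrK.
  rewrite normrN => ->.
  by move: (dle _ (Cmid _ _ Cn Cm)) ln lm; move: (n.+1%:R^-1) (m.+1%:R^-1) => a b; lra.
have cp : cvgn p.
  apply/cauchy_cvgP/cauchyP => e e0.
  have e20 : 0 < e ^+ 2 / 4 by rewrite divr_gt0// exprn_gt0.
  have [N _ NP] := near_infty_natSinv_lt (PosNum e20).
  exists (p N); exists N => // n /= Nn; rewrite -ball_normE /=.
  rewrite -ltr_sqr ?nnegrE ?(ltW e0)//; apply: le_lt_trans (dist _ _) _.
  move: (NP N (leqnn _)) (NP n Nn) => /=.
  by move: (n.+1%:R^-1) (N.+1%:R^-1) => a b; lra.
exists (limn p); split.
  apply: (closed_cvg _ Ccl _ _ cp); apply: nearW => n; exact: (pP n).1.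
move=> y Cy; rewrite -ler_sqr ?nnegrE//.
apply: le_trans (dle _ Cy).
have cd : d + n.+1%:R^-1 @[n --> \oo] --> d + 0.
  by apply: cvgD; [exact: cvg_cst|exact: cvg_harmonic].
have cu : `|u - p n| ^+ 2 @[n --> \oo] --> `|u - limn p| ^+ 2.
  rewrite expr2; under eq_fun do rewrite expr2.
  by apply: cvgM; apply: cvg_norm; apply: cvgB => //; exact: cvg_cst.
rewrite -(addr0 d); apply: (ler_cvg_to cu cd).
by apply: nearW => n; exact: ltW (pP n).2.
Qed.

Variable M : H -> H.
Hypotheses (Mmon : monotone_operator dot M) (Mcont : continuous M).

Lemma closed_Zer : closed (Zer M).
Proof.
have -> : Zer M = M @^-1` [set 0] by [].
apply: preimage_closed; first by move=> x _; exact: Mcont.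
exact: accessible_closed_set1 (hausdorff_accessible (@norm_hausdorff _ H)) _.
Qed.

Lemma Zer_midpoint (x y : H) : Zer M x -> Zer M y -> Zer M (2^-1 *: (x + y)).
Proof.
move=> Mx My; set z := 2^-1 *: (x + y).
have key (s : R) : 0 < s -> `|M z| <= `|M (z - s *: M z) - M z|.
  move=> s0; set w := z - s *: M z.
  have h1 : 0 <= dot (M w) (w - x) by have := Mmon w x; rewrite Mx subr0.
  have h2 : 0 <= dot (M w) (w - y) by have := Mmon w y; rewrite My subr0.
  have e : (w - x) + (w - y) = - (2 * s) *: M z.
    rewrite addrACA -opprD -mulr2n -scaler_nat /w scalerBr /z !scalerA.
    by rewrite divff// scale1r addrAC subrr add0r scaleNr.
  have : 0 <= dot (M w) (- (2 * s) *: M z) by rewrite -e linearDr addr_ge0.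
  rewrite linearZr/= mulNr oppr_ge0 pmulr_rle0 ?mulr_gt0// => h3.
  rewrite -ler_sqr ?nnegrE// -!dotE.
  rewrite !(linearDl, linearDr, linearNl, linearNr) /=.
  have -> : dot (M z) (M w) = dot (M w) (M z).
    by have := hermC dot (M z) (M w); rewrite expr0 mul1r.
  have : 0 <= dot (M w) (M w) by rewrite dotE sqr_ge0.
  lra.
apply/eqP; rewrite -normr_le0.
have cw : z - s *: M z @[s --> 0^'+] --> z.
  rewrite -[X in _ --> X]subr0 -(scale0r (M z)); apply: cvgB; first exact: cvg_cst.
  by apply: cvgZr_tmp; apply: cvg_at_right_filter; exact: cvg_id.
have cn : `|M (z - s *: M z) - M z| @[s --> 0^'+] --> `|M z - M z|.
  apply: cvg_norm; apply: cvgB; last exact: cvg_cst.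
  by apply: (@cvg_comp _ _ _ _ M _ _ _ cw); exact: Mcont.
rewrite subrr normr0 in cn.
apply: (ler_cvg_to (cvg_cst `|M z|) cn).
by near=> s; apply: key; near: s; exact: nbhs_right_gt.
Unshelve. all: by end_near. Qed.

Lemma metric_projection_ZerP (u : H) : Zer M !=set0 ->
  is_metric_projection (Zer M) u (metric_projection (Zer M) u).
Proof. exact: metric_projectionP closed_Zer Zer_midpoint. Qed.

End MetricProjection.

(* Main.v *)
Require Import Defs.
From HB Require Import structures.
From mathcomp Require Import all_boot all_order all_algebra.
From mathcomp Require Import all_classical all_reals all_analysis.
From mathcomp Require Import ring lra.

Set Implicit Arguments.
Unset Strict Implicit.
Unset Printing Implicit Defensive.

Import Order.TTheory GRing.Theory Num.Theory.
Import numFieldNormedType.Exports.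

Local Open Scope ring_scope.
Local Open Scope classical_set_scope.

(** The curve [x] is absolutely continuous and its derivative agrees almost
    everywhere with the continuous map [velocity], so it is continuously
    differentiable and the equation holds at every [t > t0]
    ([strong_solution_strict_derivative]).

    Monotonicity of [M] at a zero [xi] makes
    [t `^ alpha * (|x - xi|^2 - |xi|^2)] nonincreasing, so [x] is bounded. The
    rate comes from monotonicity of [M] between two points of the trajectory:
    formally, [<d/dt M(x), x'> >= 0] turns the equation into
      [d/dt (t `^ (2 alpha) |x'|^2 / 2) <= alpha t `^ (2 alpha - 2) <x, x'>].
    Since [x] need not be twice differentiable this is proved in integrated
    form, through difference quotients ([velocity_energy]). For [alpha = 1] the
    right-hand side is the derivative of [|x|^2 / 2], which is bounded. For
    [alpha <> 1] it is at most [alpha B t `^ (alpha - 2)] times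
    [t `^ alpha |x'|], where [B] bounds [|x|], and applying the inequality up to
    a maximum point of [t `^ alpha |x'|] bounds that quantity by a constant
    plus a multiple of [t `^ (alpha - 1)] when [alpha > 1], and by a constant
    when [alpha < 1]. In all cases [|x'|] has the required decay
    ([velocity_rate]), and so has [M(x) = - x' - (alpha / t) x].

    In particular [M(x(t))] tends to 0. Writing [xi] for the zero of least norm,
    demiclosedness and the variational characterization of [xi] give
    [liminf <xi, x - xi> >= 0] ([weak_liminf_projection]). Given [e > 0],
    eventually [<xi, x - xi> >= - e], and then monotonicity of [M] at [xi] makes
    [t `^ (2 alpha) * (|x - xi|^2 - e)] nonincreasing ([weighted_dist_le]), so
    [limsup |x - xi|^2 <= e]. *)

(** * Absolutely continuous curves *)

Lemma subrACA (V : zmodType) (a b c d : V) :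
  a - b - (c - d) = a - c - (b - d).
Proof. by rewrite !opprD !opprK addrACA. Qed.

Section IntervalInduction.
Variable R : realType.

(** Cousin's lemma: a property of intervals that is additive and holds of every
    short enough interval around each point of [a, b] holds of [a, b]. *)
Lemma interval_induction (Q : R -> R -> Prop) (a b : R) : a <= b ->
  (forall u w v, u <= w -> w <= v -> Q u w -> Q w v -> Q u v) ->
  (forall t, a <= t <= b -> exists2 d : R, 0 < d &
     forall u v, t - d < u -> u <= t -> t <= v -> v < t + d -> Q u v) ->
  Q a b.
Proof.
move=> ab Qadd Qloc.
pose S := [set c | a <= c <= b /\ Q a c].
have Sa : S a.
  split; first by rewrite lexx.
  have [|d d0 Qd] := Qloc a; first by rewrite lexx.
  by apply: Qd => //; lra.
have Sb : ubound S b by move=> c [/andP[]].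
have supS : has_sup S by split; [exists a|exists b].
have aS : a <= sup S by exact: (sup_upper_bound supS).
have Sleb : sup S <= b by apply: ge_sup => //; exists a.
have [|d d0 Qd] := Qloc (sup S); first by rewrite aS.
have [c Sc cgt] := sup_adherent d0 supS.
have cS : c <= sup S by exact: (sup_upper_bound supS).
have [/andP[ac _] Qac] := Sc.
pose e := Num.min b (sup S + d / 2).
have Se : sup S <= e by rewrite /e le_min Sleb; lra.
have ed : e < sup S + d by rewrite /e gt_min; apply/orP; right; lra.
have Qae : Q a e by apply: (Qadd _ c) => //; [exact: le_trans cS Se|exact: Qd].
have eS : e <= sup S.
  apply: (sup_upper_bound supS).
  split=> //; apply/andP; split; first exact: le_trans aS Se.
  by rewrite /e ge_min lexx.
suff -> : b = e by [].
move: eS; rewrite /e; case: (leP b (sup S + d / 2)) => //; lra.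
Qed.

End IntervalInduction.

Section AbsoluteContinuity.
Variables (R : realType) (H : normedModType R).
Local Notation mu := (@lebesgue_measure R).

(** Absolute continuity for finite families listed in increasing order, a form
    stable under concatenation of adjacent families. *)
Lemma absolutely_continuous_on_seq (a b : R) (f : R -> H) :
  absolutely_continuous_on a b f ->
  forall e : R, 0 < e -> exists2 d : R, 0 < d &
  forall s : seq (R * R),
    (forall p, p \in s -> [/\ a <= p.1, p.1 <= p.2 & p.2 <= b]) ->
    pairwise (fun p q => p.2 <= q.1) s ->
    \sum_(p <- s) (p.2 - p.1) < d ->
    \sum_(p <- s) `|f p.2 - f p.1| < e.
Proof.
move=> fac e e0; have [d d0 fd] := fac e e0.
exists d => // s sab sp; rewrite (big_nth (0, 0)) big_mkord => sd.
rewrite (big_nth (0, 0)) big_mkord.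
apply: (fd _ (fun i => (nth (0, 0) s i).1) (fun i => (nth (0, 0) s i).2)) => //.
  by move=> i; apply: sab; exact: mem_nth.
have sp' := pairwiseP (0, 0) sp.
move=> i j ij; have [lij|lji|/val_inj eij] := ltngtP i j.
- by left; apply: sp' => //; rewrite inE.
- by right; apply: sp' => //; rewrite inE.
- by rewrite eij eqxx in ij.
Qed.

Lemma absolutely_continuous_on_uniform (a b : R) (f : R -> H) :
  absolutely_continuous_on a b f ->
  forall e : R, 0 < e -> exists2 d : R, 0 < d &
  forall u v, a <= u -> u <= v -> v <= b -> v - u < d -> `|f v - f u| < e.
Proof.
move=> fac e e0; have [d d0 fd] := absolutely_continuous_on_seq fac e0.
exists d => // u v au uv vb uvd; have := fd [:: (u, v)].
rewrite !big_seq1; apply => //.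
by move=> p; rewrite inE => /eqP ->.
Qed.

(** Straddle lemma: at a point of derivability the increment over a short
    interval containing that point, not necessarily as an endpoint, is nearly
    the length times the derivative. *)
Lemma derivable_straddle (f : R -> H) (c : H) (k t : R) :
  derivable f t 1 -> `|'D_1 f t - c| < k -> exists2 d : R, 0 < d &
  forall u v, t - d < u -> u <= t -> t <= v -> v < t + d ->
    `|f v - f u - (v - u) *: c| <= k * (v - u).
Proof.
move=> ft Dk.
have one_side : \forall h \near (0:R)^', 
    `|h^-1 *: (f (h + t) - f t) - c| < k.
  have : (h^-1 *: (f (h + t) - f t) - c) @[h --> (0:R)^'] --> 'D_1 f t - c.
    apply: cvgB; last exact: cvg_cst.
    have := ft; rewrite /derivable /derive /=.
    by under eq_fun do rewrite /= [_%:A]mulr1.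
  move=> /cvg_norm /cvgr_lt; exact.
have [d /= d0 dP] := one_side.
exists d => // u v tdu ut tv vtd.
have key w : `|w - t| < d -> `|f w - f t - (w - t) *: c| <= k * `|w - t|.
  move=> wd; have [->|wt] := eqVneq w t.
    by rewrite !subrr scale0r subrr !normr0 mulr0.
  have wt0 : w - t != 0 by rewrite subr_eq0.
  have := dP (w - t); rewrite /ball /= sub0r normrN => /(_ wd wt0).
  rewrite subrK => lt.
  have -> : f w - f t - (w - t) *: c =
      (w - t) *: ((w - t)^-1 *: (f w - f t) - c).
    by rewrite scalerBr scalerA divff// scale1r.
  by rewrite normrZ mulrC ler_wpM2r// ltW.
have -> : f v - f u - (v - u) *: c =
    (f v - f t - (v - t) *: c) - (f u - f t - (u - t) *: c).
  rewrite subrACA -scalerBl; congr (_ - _ *: _); last by ring.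
  by rewrite opprB addrA subrK.
apply: le_trans (ler_normB _ _) _.
have := key u; have := key v.
rewrite (ger0_norm (x := v - t)) ?subr_ge0// (ler0_norm (x := u - t)) ?subr_le0//.
move=> /(_ ltac:(lra)) h1 /(_ ltac:(lra)) h2; lra.
Qed.

End AbsoluteContinuity.

Section MeanValue.
Variables (R : realType) (H : normedModType R).
Local Notation mu := (@lebesgue_measure R).

Lemma ae_open_cover (P : R -> Prop) (d : R) : 0 < d ->
  {ae mu, forall t, P t} ->
  exists U : set R, [/\ open U, ~` [set t | P t] `<=` U & (mu U < d%:E)%E].
Proof.
move=> d0 [A [mA A0 NA]].
have [|U [oU AU muU]] := @lebesgue_regularity_outer R A d mA _ d0.
  by rewrite [X in (X < _)%E]A0.
exists U; split => //; first exact: subset_trans NA AU.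
apply: le_lt_trans muU.
have mU : measurable U by exact: measurable_realfun.open_measurable.
rewrite (measureDI mu mU mA) -[leRHS]adde0; apply: leeD => //.
rewrite -[leRHS]A0; apply: le_measure; rewrite ?inE//; first exact: measurableI.
Qed.

(** Mean value inequality for absolutely continuous curves. By
    [interval_induction], every interval satisfies the estimate up to the
    increments of [f] over a family of intervals lying inside a small open
    neighbourhood of the exceptional null set, which absolute continuity makes
    negligible. *)
Lemma ae_mean_value (a b k : R) (f : R -> H) (c : H) : a <= b -> 0 <= k ->
  absolutely_continuous_on a b f ->
  {ae mu, forall t, a <= t <= b -> derivable f t 1 /\ `|'D_1 f t - c| <= k} ->
  `|f b - f a - (b - a) *: c| <= k * (b - a).
Proof.
move=> ab k0 fac fae; apply/ler_addgt0Pr => e e0.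
pose e1 := e / (b - a + 2).
have ba0 : 0 < b - a + 2 by lra.
have e10 : 0 < e1 by rewrite divr_gt0.
have ee1 : e1 * (b - a + 2) = e by rewrite /e1 divfK// gt_eqF.
have [d d0 fd] := absolutely_continuous_on_seq fac e10.
have c1 : 0 < `|c| + 1 by rewrite ltr_wpDl.
pose d1 := Num.min d (e1 / (`|c| + 1)).
have d10 : 0 < d1 by rewrite lt_min d0 divr_gt0.
have [U [oU NU muU]] := ae_open_cover d10 fae.
pose L (s : seq (R * R)) := \sum_(p <- s) (p.2 - p.1).
pose V (s : seq (R * R)) := \sum_(p <- s) `|f p.2 - f p.1|.
(* The lengths are compared with the measure of U on a half-open interval so
   that the bound adds up exactly over adjacent intervals. *)
pose Q u v := exists s : seq (R * R), 
  [/\ forall p, p \in s -> [/\ u <= p.1, p.1 <= p.2 & p.2 <= v],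
      pairwise (fun p q => p.2 <= q.1) s,
      ((L s)%:E <= mu (U `&` `[u, v[))%E &
      a <= u -> v <= b ->
      `|f v - f u - (v - u) *: c| <= (k + e1) * (v - u) + V s + L s * `|c|].
suff [s [sab sp sL]] : Q a b.
  move=> /(_ (lexx _) (lexx _)) sV.
  have Ld1 : L s < d1.
    rewrite -lte_fin; apply: le_lt_trans sL _; apply: le_lt_trans muU.
    by apply: le_measure; rewrite ?inE//; [apply: measurableI => //|];
      exact: measurable_realfun.open_measurable.
  have L0 : 0 <= L s.
    by rewrite /L big_seq; apply: sumr_ge0 => p /sab[_ ? _]; rewrite subr_ge0.
  have Vs : V s < e1.
    apply: fd => //; apply: lt_le_trans Ld1 _; by rewrite ge_min lexx.
  have Lc : L s * `|c| <= e1.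
    apply: (@le_trans _ _ (L s * (`|c| + 1))).
      by rewrite ler_wpM2l// lerDl.
    rewrite -ler_pdivlMr//; apply/ltW; apply: lt_le_trans Ld1 _.
    by rewrite ge_min lexx orbT.
  apply: le_trans sV _; rewrite -ee1.
  by move: Vs Lc; rewrite -/(V s); nra.
apply: interval_induction => //.
- move=> u w v uw wv [s1 [s1b s1p s1L s1V]] [s2 [s2b s2p s2L s2V]].
  exists (s1 ++ s2); split.
  + move=> p; rewrite mem_cat => /orP[/s1b|/s2b] [h1 h2 h3]; split => //.
      exact: le_trans h3 wv.
    exact: le_trans uw h1.
  + rewrite pairwise_cat s1p s2p !andbT; apply/allrelP => p q /s1b[_ _ pw] /s2b[wq _ _].
    exact: le_trans pw wq.
  + rewrite /L big_cat/= EFinD.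
    have -> : U `&` `[u, v[ = (U `&` `[u, w[) `|` (U `&` `[w, v[).
      rewrite -setIUr; congr (_ `&` _).
      apply/seteqP; split => x /=; rewrite !in_itv/=.
        by move=> /andP[-> ->]; case: (ltP x w); [left|right].
      move=> [] /andP[h1 h2]; apply/andP; split => //.
        exact: lt_le_trans h2 wv.
      exact: le_trans uw h1.
    rewrite measureU; first exact: leeD.
    * by apply: measurableI => //; exact: measurable_realfun.open_measurable.
    * by apply: measurableI => //; exact: measurable_realfun.open_measurable.
    * apply/seteqP; split => x //= [[_ /=]]; rewrite in_itv/= => /andP[_ xw] [_].
      by rewrite /= in_itv/= leNgt xw.
  + move=> au vb; have := s1V au (le_trans wv vb); have := s2V (le_trans au uw) vb.
    have -> : f v - f u - (v - u) *: c =
      (f v - f w - (v - w) *: c) + (f w - f u - (w - u) *: c).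
      rewrite addrACA -opprD -scalerDl; congr (_ - _ *: _); last by ring.
      by rewrite addrA subrK.
    move=> h2 h1; apply: le_trans (ler_normD _ _) _.
    rewrite /V /L !big_cat/= -/(V s1) -/(V s2) -/(L s1) -/(L s2); lra.
- move=> t tab; have [Ut|nUt] := pselect (U t).
    have [d' /= d'0 dU] : nbhs t U by exact: open_nbhs_nbhs.
    exists d' => // u v tu ut tv vt; exists [:: (u, v)].
    have uv : u <= v by exact: le_trans ut tv.
    split => //.
    + by move=> p; rewrite inE => /eqP ->.
    + rewrite /L big_seq1/=.
      suff -> : U `&` `[u, v[ = `[u, v[.
        rewrite lebesgue_measure_itv/= lte_fin; case: ltP => //.
        by rewrite lee_fin subr_le0.
      apply: setIidr => x /=; rewrite in_itv/= => /andP[ux xv].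
      by apply: dU; rewrite /ball /= ltr_norml; apply/andP; split; lra.
    + move=> _ _; rewrite /V /L !big_seq1/=.
      apply: le_trans (ler_normB _ _) _; rewrite normrZ ger0_norm ?subr_ge0//.
      suff : 0 <= (k + e1) * (v - u) by lra.
      by rewrite mulr_ge0 ?subr_ge0// addr_ge0// ltW.
  have [] : a <= t <= b -> derivable f t 1 /\ `|'D_1 f t - c| <= k.
    by apply: contrapT => nP; apply: nUt; exact: NU.
  done.
  move=> ft Dk.
  have [|d' d'0 dP] := @derivable_straddle _ _ f c (k + e1) t ft.
    lra.
  exists d' => // u v tu ut tv vt; exists [::]; split => //.
    by rewrite /L big_nil.
  by move=> _ _; rewrite /V /L !big_nil mul0r !addr0; exact: dP.
Qed.
End MeanValue.

(** * Inner product calculus *)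

Section Hilbert.
Variables (R : realType) (H : normedModType R).
Variables (dot : {dot H for idfun}).
Hypothesis dotE : forall u : H, dot u u = `|u| ^+ 2.

Lemma dotC (u v : H) : dot u v = dot v u.
Proof. by have := hermC dot u v; rewrite expr0 mul1r. Qed.

Lemma dotBB (u v : H) : `|u - v| ^+ 2 = `|u| ^+ 2 - 2 * dot u v + `|v| ^+ 2.
Proof.
by rewrite -!dotE !(linearDl, linearDr, linearNl, linearNr) /= (dotC v u); ring.
Qed.

Lemma dot_polar (u v : H) :
  dot u v = (`|u| ^+ 2 + `|v| ^+ 2 - `|u - v| ^+ 2) / 2.
Proof. by rewrite dotBB; field. Qed.

Lemma dot_le_norm (u v : H) : `|dot u v| <= `|u| * `|v|.
Proof.
wlog uv : u / 0 <= dot u v => [hw|].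
  have [/hw//|uv0] := leP 0 (dot u v).
  have := hw (- u); rewrite linearNl /= !normrN; apply; lra.
rewrite ger0_norm//; have [->|v0] := eqVneq v 0.
  by rewrite linear0 normr0 mulr0.
have nv : 0 < `|v| by rewrite normr_gt0.
have : 0 <= `| `|v| *: u - `|u| *: v | ^+ 2 by exact: sqr_ge0.
rewrite dotBB !normrZ !normr_id linearZr linearZl_LR /=.
have [->|u0] := eqVneq u 0; first by rewrite linear0l normr0 mul0r.
have nu : 0 < `|u| by rewrite normr_gt0.
move: (dot u v) uv (`|u|) (`|v|) nu nv => p p0 a b a0 b0 h.
have : 0 <= (a * b) * (a * b - p) by nra.
by rewrite pmulr_rge0 ?mulr_gt0// subr_ge0.
Qed.

Lemma cvg_dot T (F : set_system T) {FF : Filter F} (f g : T -> H) (a b : H) :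
  f @ F --> a -> g @ F --> b -> dot (f t) (g t) @[t --> F] --> dot a b.
Proof.
move=> fa gb; rewrite dot_polar; under eq_fun do rewrite dot_polar.
have sq (h : T -> H) c : h @ F --> c -> `|h t| ^+ 2 @[t --> F] --> `|c| ^+ 2.
  move=> hc; rewrite expr2; under eq_fun do rewrite expr2.
  by apply: cvgM; exact: cvg_norm.
apply: cvgM; last exact: cvg_cst.
apply: cvgB; last by apply: (sq (fun t => f t - g t)); exact: cvgB.
by apply: cvgD; exact: sq.
Qed.

Lemma is_derive_sqnorm (z : R -> H) (t : R) (D : H) : is_derive t 1 z D ->
  is_derive t 1 (fun s => `|z s| ^+ 2) (2 * dot D (z t)).
Proof.
move=> [zt zD].
have zc : z h @[h --> t] --> z t.
  by apply: differentiable_continuous; exact/derivable1_diffP.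
have lim : h^-1 *: (`|z (h *: 1 + t)| ^+ 2 - `|z t| ^+ 2) @[h --> (0:R)^'] 
    --> 2 * dot D (z t).
  have -> : 2 * dot D (z t) = dot D (z t + z t).
    by rewrite linearDr mulr_natl mulr2n.
  have -> : (fun h : R => h^-1 *: (`|z (h *: 1 + t)| ^+ 2 - `|z t| ^+ 2)) =
     (fun h => dot (h^-1 *: (z (h *: 1 + t) - z t)) (z (h *: 1 + t) + z t)).
    apply/funext => h; rewrite linearZl_LR /= -!dotE.
    rewrite !(linearDl, linearDr, linearNl, linearNr) /= (dotC (z t) (z (_ + t))).
    by rewrite /GRing.scale/=; ring.
  apply: cvg_dot.
    by move: zt; rewrite -zD.
  apply: cvgD; last exact: cvg_cst.
  have hc : h%:A + t @[h --> (0:R)^'] --> t.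
    rewrite -[X in _ --> X]add0r; apply: cvgD; last exact: cvg_cst.
    by under eq_fun do rewrite [_%:A]mulr1; exact: nbhs_dnbhs.
  exact: cvg_comp hc zc.
split; first by apply/cvg_ex; exists (2 * dot D (z t)).
exact: cvg_lim lim.
Qed.

End Hilbert.

(** * Strict derivatives *)

Section ContinuousDerivative.
Variables (R : realType) (H : normedModType R).

(** [f] has strict derivative [c] at [t]: the difference quotients over all the
    intervals close to [t], whether or not they contain [t], are close to [c]. *)
Definition strict_derivative (f : R -> H) (t : R) (c : H) :=
  forall e : R, 0 < e -> exists2 d : R, 0 < d &
  forall u v, t - d < u -> u <= v -> v < t + d ->
    `|f v - f u - (v - u) *: c| <= e * (v - u).

(** An absolutely continuous curve whose derivative agrees almost everywhere
    with a map continuous at [t] is strictly derivable at [t]. *)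
Lemma ae_strict_derivative (f F : R -> H) (a b t : R) : a < t < b ->
  absolutely_continuous_on a b f ->
  {ae @lebesgue_measure R, forall s, a < s < b ->
     derivable f s 1 /\ 'D_1 f s = F s} ->
  F s @[s --> t] --> F t ->
  strict_derivative f t (F t).
Proof.
move=> /andP[aT tb] fac fae Fc e e0.
have /= : \forall s \near t, `|F t - F s| < e by move/cvgrPdist_lt : Fc; exact.
move=> [d /= d0 dF]; pose d' := Num.min d (Num.min (t - a) (b - t)).
have d'0 : 0 < d' by rewrite !lt_min d0 !subr_gt0 aT.
have [d'd d'a d'b] : [/\ d' <= d, d' <= t - a & d' <= b - t].
  by rewrite /d' !ge_min !lexx !orbT.
exists d' => // u v tu uv vt; apply: ae_mean_value => //; first exact: ltW.
  move=> e' e'0; have [k k0 kP] := fac _ e'0.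
  exists k => // n p q pq dis sk; apply: (kP n p q) => // i.
  by have [h1 h2 h3] := pq i; split=> //; lra.
apply: (@filterS _ _ (ae_filter_ringOfSetsType _) _ _ _ fae) => s sD /andP[us sv].
have [|fs ->] := sD; first by apply/andP; split; lra.
split => //; rewrite distrC; apply/ltW/dF; rewrite /ball/= ltr_norml.
by apply/andP; split; lra.
Qed.

(** The forward difference quotient converges jointly in the base point and in
    the step. *)
Lemma strict_derivative_dq (f : R -> H) (t : R) (c : H) :
  strict_derivative f t c ->
  p.2^-1 *: (f (p.1 + p.2) - f p.1) @[p --> filter_prod (nbhs t) (0:R)^'+] --> c.
Proof.
move=> fc; apply/cvgrPdist_le => e e0; have [d d0 dP] := fc _ e0.
have d20 : 0 < d / 2 by lra.
exists (ball t (d / 2), [set h : R | 0 < h < d / 2]) => /=.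
  split; first exact: nbhsx_ballx.
  near=> h => /=; apply/andP; split; near: h; first exact: nbhs_right_gt.
  exact: nbhs_right_lt.
move=> [s h] /= [] ; rewrite /ball/= ltr_norml => /andP[h1 h2] /andP[h0 hd].
have -> : c - h^-1 *: (f (s + h) - f s) =
    - (h^-1 *: (f (s + h) - f s - (s + h - s) *: c)).
  by rewrite [in RHS]scalerBr scalerA opprB (addrC s) addrK mulVf ?gt_eqF// scale1r.
rewrite normrN normrZ ger0_norm ?invr_ge0 ?(ltW h0)// mulrC ler_pdivrMr//.
have := dP s (s + h); rewrite (addrC s) addrK; apply; lra.
Unshelve. all: by end_near. Qed.

Lemma strict_derivative_is_derive (f : R -> H) (t : R) (c : H) :
  strict_derivative f t c -> is_derive t 1 f c.
Proof.
move=> fc; have lim : h^-1 *: (f (h *: 1 + t) - f t) @[h --> (0:R)^'] --> c.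
  apply/cvgrPdist_le => e e0; have [d d0 dP] := fc _ e0.
  exists d => // h; rewrite /ball /= sub0r normrN ltr_norml => /andP[hd1 hd2] h0.
  rewrite [_%:A]mulr1.
  have -> : c - h^-1 *: (f (h + t) - f t) =
      - (h^-1 *: (f (h + t) - f t - h *: c)).
    by rewrite [in RHS]scalerBr scalerA opprB mulVf// scale1r.
  rewrite normrN normrZ normfV mulrC ler_pdivrMr ?normr_gt0//.
  have [hp|hn] := leP 0 h.
    rewrite ger0_norm//; have := dP t (h + t); rewrite addrK; apply; lra.
  rewrite ltr0_norm//.
  have := dP (h + t) t; rewrite opprD addrCA subrr addr0.
  rewrite -normrN scaleNr opprD opprB opprK; apply; lra.
split; first by apply/cvg_ex; exists c.
exact: cvg_lim lim.
Qed.

End ContinuousDerivative.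

Section RealCalculus.
Variable R : realType.

Lemma is_derive_increment_le (G g : R -> R) (a b k : R) : a <= b ->
  (forall t, a <= t <= b -> is_derive t 1 G (g t)) ->
  (forall t, a <= t <= b -> g t <= k) ->
  G b - G a <= k * (b - a).
Proof.
move=> ab Gg gk.
have [c cab ->] := @MVT_segment R G g a b ab
  (fun t tab => Gg t ltac:(by move: tab; rewrite in_itv/= => /andP[/ltW-> /ltW->]))
  ltac:(by apply: derivable_within_continuous => t; rewrite in_itv/= => /Gg[]).
by rewrite ler_wpM2r ?subr_ge0// gk//; move: cab; rewrite in_itv.
Qed.

End RealCalculus.

(** * Real derivatives of weights *)

Section PowerCalculus.
Variable R : realType.

Lemma eq_cvg_right (f g : R -> R) (t l : R) : (forall h, t < h -> f h = g h) ->
  f h @[h --> t^'+] --> l -> g h @[h --> t^'+] --> l.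
Proof.
move=> fg fl; apply: cvg_trans fl; apply: near_eq_cvg.
by near=> h; apply: fg; near: h; exact: nbhs_right_gt.
Unshelve. all: by end_near. Qed.

Lemma is_derive_mulr (f g : R -> R) (t df dg : R) :
  is_derive t 1 f df -> is_derive t 1 g dg ->
  is_derive t 1 (fun s => f s * g s) (df * g t + f t * dg).
Proof.
move=> Df Dg; have D := is_deriveM Df Dg.
by apply: is_derive_eq D _; rewrite /GRing.scale/=; ring.
Qed.

Lemma is_derive_powR_shift (r h t : R) : 0 < t + h ->
  is_derive t 1 (fun s : R => (s + h) `^ r) (r * (t + h) `^ (r - 1)).
Proof.
move=> th; have D := is_derive1_powR r th.
have S := is_derive_shift t (1:R) h.
have := @is_derive1_comp R (fun s => s `^ r) (shift h) t _ _ D S.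
by rewrite mulr1.
Qed.

Lemma powR_pred (t r : R) : 0 < t -> t `^ r = t `^ (r - 1) * t.
Proof.
move=> t0; rewrite -[X in _ = _ * X]powRr1 ?ltW// -powRD ?subrK//.
by rewrite (gt_eqF t0) implybT.
Qed.

Lemma cvg_powR (r t : R) : 0 < t -> s `^ r @[s --> t] --> t `^ r.
Proof.
move=> t0; have [/derivable1_diffP D _] := is_derive1_powR r t0.
exact: differentiable_continuous D.
Qed.

End PowerCalculus.

(** * The trajectory and its velocity *)

(** The right-hand side of the evolution equation solved for the derivative of
    [x]. *)
Definition velocity (R : realType) (H : normedModType R) (M : H -> H)
    (alpha : R) (x : R -> H) (t : R) : H :=
  - M (x t) - (alpha / t) *: x t.

Lemma velocity_cvg (R : realType) (H : normedModType R) (M : H -> H)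
    (alpha : R) (x : R -> H) (t : R) : continuous M -> t != 0 ->
  x s @[s --> t] --> x t ->
  velocity M alpha x s @[s --> t] --> velocity M alpha x t.
Proof.
move=> Mcont t0 xc; apply: cvgB.
  by apply: cvgN; apply: (@cvg_comp _ _ _ x M _ (nbhs (x t))) => //; exact: Mcont.
apply: cvgZ => //; apply: cvgM; first exact: cvg_cst.
by apply: cvgV => //; exact: cvg_id.
Qed.

Section Trajectory.
Variables (R : realType) (H : normedModType R).
Variables (dot : {dot H for idfun}).
Hypothesis dotE : forall u : H, dot u u = `|u| ^+ 2.
Variables (M : H -> H) (alpha t0 : R) (x : R -> H).
Hypotheses (Mmon : monotone_operator dot M) (Mcont : continuous M).
Hypotheses (t0_gt0 : 0 < t0) (alpha_gt0 : 0 < alpha).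

Local Notation F := (velocity M alpha x).

Hypothesis xD : forall t, t0 < t -> strict_derivative x t (F t).

Let xF t : t0 < t -> is_derive t 1 x (F t).
Proof. by move=> /xD; exact: strict_derivative_is_derive. Qed.

Lemma trajectory_continuous t : t0 < t -> x s @[s --> t] --> x t.
Proof.
move=> /xF[/derivable1_diffP xt _].
exact: differentiable_continuous xt.
Qed.

Lemma velocity_continuous t : t0 < t -> F s @[s --> t] --> F t.
Proof.
move=> tt0; apply: velocity_cvg => //; last exact: trajectory_continuous.
by rewrite gt_eqF// (lt_trans t0_gt0).
Qed.

Lemma is_derive_dist (xi : H) t : t0 < t ->
  is_derive t 1 (fun s => `|x s - xi| ^+ 2) (2 * dot (F t) (x t - xi)).
Proof.
move=> /xF Dx; apply: (is_derive_sqnorm dotE) => //.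
have := is_deriveB Dx (is_derive_cst xi t (1 : R)).
by rewrite subr0.
Qed.

Lemma velocity_dot_le (xi : H) t : Zer M xi ->
  dot (F t) (x t - xi) <= - (alpha / t * dot (x t) (x t - xi)).
Proof.
move=> Mxi; have := Mmon (x t) xi; rewrite Mxi subr0 => h.
rewrite /velocity linearBl linearNl linearZl_LR /=; lra.
Qed.

(** [t `^ alpha * (|x t - xi|^2 - |xi|^2)] is nonincreasing for every zero [xi]
    of [M]. *)
Lemma trajectory_bounded (xi : H) (a : R) : t0 < a -> Zer M xi ->
  exists2 B, 0 <= B & forall t, a <= t -> `|x t| <= B.
Proof.
move=> at0 Mxi; have a0 : 0 < a by exact: lt_trans at0.
pose C := `|x a - xi| ^+ 2 + `|xi| ^+ 2.
have C0 : 0 <= C by rewrite addr_ge0// sqr_ge0.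
have key t : a <= t -> `|x t - xi| ^+ 2 <= C.
  move=> at_; have t_gt0 : 0 < t by exact: lt_le_trans at_.
  (* The shift by 0 puts the weight in the form of [is_derive_powR_shift]. *)
  have dG s : a <= s <= t -> is_derive s 1
      (fun s => (s + 0) `^ alpha * (`|x s - xi| ^+ 2 - `|xi| ^+ 2))
      (alpha * (s + 0) `^ (alpha - 1) * (`|x s - xi| ^+ 2 - `|xi| ^+ 2) +
       (s + 0) `^ alpha * (2 * dot (F s) (x s - xi) - 0)).
    move=> /andP[as_ _]; apply: is_derive_mulr.
      by apply: is_derive_powR_shift; rewrite addr0 (lt_le_trans a0).
    have Ds := is_derive_dist xi (lt_le_trans at0 as_).
    exact: is_deriveB Ds (is_derive_cst _ _ _).
  have dG_le0 s : a <= s <= t ->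
      alpha * (s + 0) `^ (alpha - 1) * (`|x s - xi| ^+ 2 - `|xi| ^+ 2) +
       (s + 0) `^ alpha * (2 * dot (F s) (x s - xi) - 0) <= 0.
    move=> /andP[as_ _]; have s0 : 0 < s by exact: lt_le_trans as_.
    rewrite addr0 subr0 (powR_pred alpha s0).
    have := velocity_dot_le s Mxi.
    have := dotBB dotE (x s) xi.
    have -> : dot (x s) (x s - xi) = `|x s| ^+ 2 - dot (x s) xi.
      by rewrite linearBr /= dotE.
    have := powR_gt0 (alpha - 1) s0; have := sqr_ge0 (`|x s|).
    move: (s `^ _) (dot (F s) _) (dot (x s) xi) => w p q.
    move: (`|x s| ^+ 2) (`|x s - xi| ^+ 2) (`|xi| ^+ 2) => X Y Z X0 w0 YE pq.
    have h : p * s <= - alpha * (X - q).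
      have -> : - alpha * (X - q) = - (alpha / s * (X - q)) * s.
        by field; rewrite gt_eqF.
      by rewrite ler_pM2r.
    have -> : alpha * w * (Y - Z) + w * s * (2 * p) =
       w * (alpha * (Y - Z) + 2 * (p * s)) by ring.
    rewrite pmulr_rle0// YE; have := mulr_ge0 (ltW alpha_gt0) X0; nra.
  have := is_derive_increment_le at_ dG dG_le0.
  rewrite mul0r !addr0 => h.
  have wa := powR_gt0 alpha a0; have wt := powR_gt0 alpha t_gt0.
  have wat : a `^ alpha <= t `^ alpha.
    by apply: ge0_ler_powR => //; rewrite ?nnegrE ltW.
  move: h wa wt wat; rewrite /C; move: (a `^ _) (t `^ _) => w w'.
  have := sqr_ge0 (`|xi|); have := sqr_ge0 (`|x a - xi|).
  move: (`|xi| ^+ 2) (`|x a - xi| ^+ 2) (`|x t - xi| ^+ 2) => X Y Z X0 Y0 h w0 w'0 ww.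
  rewrite -(ler_pM2l w'0); nra.
exists (C + 1 + `|xi|); first by rewrite !addr_ge0.
move=> t /key h; rewrite -[x t](subrK xi); apply: le_trans (ler_normD _ _) _.
rewrite lerD2r; have := normr_ge0 (x t - xi); move: h; move: (`|x t - xi|) => n.
nra.
Qed.

(** Monotonicity tested on two points of the trajectory. *)
Let acceleration_le (s t : R) : t0 < s -> t0 < t ->
  dot (F t - F s) (x t - x s) <=
  - (alpha / t) * `|x t - x s| ^+ 2 +
  alpha * (t - s) / (s * t) * dot (x s) (x t - x s).
Proof.
move=> ss0 tt0; have s0 : 0 < s by exact: lt_trans ss0.
have t_0 : 0 < t by exact: lt_trans tt0.
have := Mmon (x t) (x s); set D := x t - x s => h.
have -> : F t - F s = - (M (x t) - M (x s)) - (alpha / t) *: D +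
   (alpha * (t - s) / (s * t)) *: x s.
  have -> : alpha * (t - s) / (s * t) = alpha / s - alpha / t.
    by field; rewrite !gt_eqF.
  rewrite /velocity /D scalerBr scalerBl !opprD !opprK.
  rewrite [LHS]addrACA -[RHS]addrA; congr (_ + _).
  by rewrite [X in _ = _ + X]addrC [RHS]addrA addrK.
rewrite linearDl /= linearBl linearNl !linearZl_LR /= dotE /GRing.scale/=.
by move: (_ * dot (x s) D) h => w h; lra.
Qed.

(** Integrated form of
    [d/dt (t `^ (2 alpha) |x'|^2 / 2) <= alpha t `^ (2 alpha - 2) <x, x'>]: if
    the derivative of [r] bounds the right-hand side, the weighted kinetic
    energy minus [r] does not increase. As [x'] need not be derivable, the
    inequality is proved for [Psi h], where the difference quotient of step [h]
    replaces [x'] and the weight is taken at [s + h]; its derivative is at most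
    [Phi (s, h)], and [Phi] has a nonpositive limit as [(s, h)] tends to
    [(t, 0)]. Letting [h] tend to 0 on a short interval and then gluing with
    [interval_induction] gives the result. *)
Lemma velocity_energy (r r' : R -> R) (a b : R) : t0 < a -> a <= b ->
  (forall t, t0 < t -> is_derive t 1 r (r' t)) ->
  (forall t, t0 < t -> r' s @[s --> t] --> r' t) ->
  (forall t, a <= t <= b ->
    alpha * (t `^ (alpha *+ 2 - 2)) * dot (x t) (F t) <= r' t) ->
  b `^ (alpha *+ 2) * `|F b| ^+ 2 / 2 - r b <=
  a `^ (alpha *+ 2) * `|F a| ^+ 2 / 2 - r a.
Proof.
move=> at0 ab dr cr' hr.
pose E t := t `^ (alpha *+ 2) * `|F t| ^+ 2 / 2 - r t.
rewrite -[leLHS]/(E b) -[leRHS]/(E a) -subr_le0.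
apply/ler_addgt0Pr => e0 e00; rewrite add0r.
pose e := e0 / (b - a + 1).
have ba1 : 0 < b - a + 1 by lra.
have e_gt0 : 0 < e by rewrite divr_gt0.
apply: (@le_trans _ _ (e * (b - a))); last first.
  by rewrite /e mulrAC ler_pdivrMr// ler_pM2l//; lra.
pose Psi h s := (s + h) `^ (alpha *+ 2) * `|x (s + h) - x s| ^+ 2 * 
   (2^-1 / h ^+ 2) - r s.
pose Phi (p : R * R) := alpha * (p.1 + p.2) `^ (alpha *+ 2 - 1) / p.1 *
    dot (x p.1) (p.2^-1 *: (x (p.1 + p.2) - x p.1)) - r' p.1.
apply: (interval_induction (Q := fun u v => E v - E u <= e * (v - u))) => //.
  by move=> u w v uw wv h1 h2; lra.
move=> t /andP[a_t t_b]; have tt0 : t0 < t by exact: lt_le_trans a_t.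
have t_gt0 : 0 < t by exact: lt_trans tt0.
(* The shape [t + 0] is the limit of [s + h]. *)
have PhiP : Phi p @[p --> filter_prod (nbhs t) (0:R)^'+] -->
   alpha * (t + 0) `^ (alpha *+ 2 - 1) / t * dot (x t) (F t) - r' t.
  have c1 : p.1 @[p --> filter_prod (nbhs t) (0:R)^'+] --> t by exact: cvg_fst.
  have c2 : p.2 @[p --> filter_prod (nbhs t) (0:R)^'+] --> (0:R).
    apply: cvg_trans; first exact: cvg_snd.
    by apply: cvg_at_right_filter; exact: cvg_id.
  have c3 : r' p.1 @[p --> filter_prod (nbhs t) (0:R)^'+] --> r' t.
    exact: (cvg_comp _ _ c1 (cr' _ tt0)).
  apply: cvgB => //.
  apply: cvgM.
    apply: cvgM; last by apply: cvgV => //; rewrite gt_eqF.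
    apply: cvgM; first exact: cvg_cst.
    apply: (@cvg_comp _ _ _ _ (fun s : R => s `^ (alpha *+ 2 - 1)) _ (nbhs (t + 0))).
      exact: cvgD.
    by apply: cvg_powR; rewrite addr0.
  apply: (cvg_dot dotE).
    exact: (cvg_comp _ _ c1 (trajectory_continuous tt0)).
  exact: strict_derivative_dq (xD tt0).
have [[A B] /= [At B0] AB] : \forall p \near filter_prod (nbhs t) (0:R)^'+, Phi p < e.
  move/cvgr_lt : PhiP; apply.
  rewrite addr0; have := hr t; rewrite a_t t_b => /(_ isT).
  have -> : alpha *+ 2 - 2 = alpha *+ 2 - 1 - 1 by ring.
  rewrite (powR_pred (alpha *+ 2 - 1) t_gt0).
  have -> : forall w, alpha * (w * t) / t = alpha * w.
    by move=> w; field; rewrite gt_eqF.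
  by move=> h; lra.
have [d /= d0 dA] := At.
exists (Num.min d (t - t0)); first by rewrite lt_min d0 subr_gt0.
move=> u v tu ut tv vt.
have [udt ut0] : t - d < u /\ t0 < u.
  by move: tu; rewrite ltrBlDr -ltrBlDl lt_min => /andP[h1 h2]; split; lra.
have {}vt : v < t + d by move: vt; rewrite -ltrBlDl lt_min => /andP[h1 h2]; lra.
have uv : u <= v by exact: le_trans ut tv.
have step h : 0 < h -> B h -> Psi h v - Psi h u <= e * (v - u).
  move=> h0 Bh.
  have dPsi s : u <= s <= v -> is_derive s 1 (Psi h)
     ((alpha *+ 2 * (s + h) `^ (alpha *+ 2 - 1) * `|x (s + h) - x s| ^+ 2 +
       (s + h) `^ (alpha *+ 2) * (2 * dot (F (s + h) - F s) (x (s + h) - x s))) *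
        (2^-1 / h ^+ 2) + 
        (s + h) `^ (alpha *+ 2) * `|x (s + h) - x s| ^+ 2 * 0 - r' s).
    move=> /andP[us sv]; have ss0 : t0 < s by exact: lt_le_trans us.
    have s_gt0 : 0 < s by exact: lt_trans ss0.
    have sh0 : t0 < s + h by lra.
    apply: (is_deriveB _ (dr _ ss0)).
    apply: is_derive_mulr.
      apply: is_derive_mulr; first by apply: is_derive_powR_shift; lra.
      apply: (is_derive_sqnorm dotE).
      apply: is_deriveB; last exact: xF.
      apply: strict_derivative_is_derive => k k0.
      have [d' d'0 d'P] := xD sh0 k0.
      exists d' => // p q h1 h2 h3.
      have := d'P (p + h) (q + h).
      rewrite [p + h]addrC addrKA (addrC h p); apply; lra.
  apply: (is_derive_increment_le uv dPsi) => s /andP[us sv].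
  have ss0 : t0 < s by exact: lt_le_trans us.
  have s_gt0 : 0 < s by exact: lt_trans ss0.
  have sh0 : t0 < s + h by lra.
  have sh_gt0 : 0 < s + h by lra.
  have As : A s.
    by apply: dA; rewrite /ball/= ltr_norml; apply/andP; split; lra.
  apply: le_trans (ltW (AB (s, h) (conj As Bh))).
  rewrite mulr0 addr0 lerD2r /Phi /=.
  have := acceleration_le ss0 sh0.
  have -> : dot (x s) (h^-1 *: (x (s + h) - x s)) =
    h^-1 * dot (x s) (x (s + h) - x s) by rewrite linearZr.
  rewrite (powR_pred (alpha *+ 2) sh_gt0).
  have := powR_gt0 (alpha *+ 2 - 1) sh_gt0.
  have -> : s + h - s = h by ring.
  move: (_ `^ _) (dot (F _ - _) _) (dot (x s) _) (`|_| ^+ 2) => w p q X w0 pq.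
  have {}pq : p * (s + h) <= - alpha * X + alpha * h / s * q.
    have -> : - alpha * X + alpha * h / s * q =
      (- (alpha / (s + h)) * X + alpha * h / (s * (s + h)) * q) * (s + h).
      by field; rewrite !gt_eqF.
    by rewrite ler_pM2r.
  have -> : (alpha *+ 2 * w * X + w * (s + h) * (2 * p)) * (2^-1 / h ^+ 2) =
     w * (alpha * X + p * (s + h)) / h ^+ 2.
    by field; rewrite gt_eqF.
  rewrite ler_pdivrMr ?exprn_gt0//.
  have -> : alpha * w / s * (h^-1 * q) * h ^+ 2 = w * (alpha * h / s * q).
    by field; rewrite !gt_eqF.
  by rewrite ler_pM2l//; lra.
have lim s : t0 < s -> Psi h s @[h --> (0:R)^'+] --> E s.
  move=> ss0; apply: cvgB; last exact: cvg_cst.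
  have s_gt0 : 0 < s by exact: lt_trans ss0.
  have dq : h^-1 *: (x (s + h) - x s) @[h --> (0:R)^'+] --> F s.
    have cp : (s, h) @[h --> (0:R)^'+] --> filter_prod (nbhs s) (0:R)^'+.
      move=> P [[A' B'] /= [As' Bh'] AB'].
      apply: (@filterS _ (0:R)^'+ _ B') => // h Bh; apply: AB'; split => //=.
      exact: nbhs_singleton As'.
    exact: (cvg_comp _ _ cp (strict_derivative_dq (xD ss0))).
  have sh : (s + h) `^ (alpha *+ 2) @[h --> (0:R)^'+] --> s `^ (alpha *+ 2).
    have shc : s + h @[h --> (0:R)^'+] --> s + 0.
      apply: cvgD; first exact: cvg_cst.
      by apply: cvg_at_right_filter; exact: cvg_id.
    rewrite addr0 in shc.
    apply: (@cvg_comp _ _ _ _ (fun s : R => s `^ (alpha *+ 2)) _ _ _ shc).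
    exact: cvg_powR.
  have := cvgM (cvgM sh (cvg_dot dotE dq dq)) (cvg_cst (2^-1 : R)).
  rewrite dotE => c; apply: (eq_cvg_right _ (c _ _ _ _)) => h h0.
  rewrite /= dotE normrZ ger0_norm ?invr_ge0 ?ltW//.
  by field; rewrite gt_eqF.
have cl : Psi h v - Psi h u @[h --> (0:R)^'+] --> E v - E u.
  by apply: cvgB; apply: lim => //; exact: lt_le_trans uv.
apply: (ler_cvg_to cl (cvg_cst _ (F := (0:R)^'+))).
near=> h; apply: step; near: h; first exact: nbhs_right_gt.
exact: B0.
Unshelve. all: by end_near. Qed.

End Trajectory.

(** * Decay rate of the velocity *)

Lemma powR_double (R : realType) (t r : R) : t `^ (r *+ 2) = (t `^ r) ^+ 2.
Proof. by rewrite -mulr_natr powRrM powR_mulrn ?powR_ge0. Qed.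

Section Rates.
Variables (R : realType) (H : normedModType R).
Variables (dot : {dot H for idfun}).
Hypothesis dotE : forall u : H, dot u u = `|u| ^+ 2.
Variables (M : H -> H) (alpha t0 : R) (x : R -> H).
Hypotheses (Mmon : monotone_operator dot M) (Mcont : continuous M).
Hypotheses (t0_gt0 : 0 < t0) (alpha_gt0 : 0 < alpha).
Local Notation F := (velocity M alpha x).
Hypothesis xD : forall t, t0 < t -> strict_derivative x t (F t).
Variables (a B : R).
Hypotheses (at0 : t0 < a) (B0 : 0 <= B) (xB : forall t, a <= t -> `|x t| <= B).

Let a_gt0 : 0 < a. Proof. exact: lt_trans at0. Qed.

(** For [alpha = 1] the right-hand side of the energy inequality is the exact
    derivative of [|x|^2 / 2]. *)
Lemma velocity_rate_eq1 (t : R) : alpha = 1 -> a <= t ->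
  t * `|F t| <= a * `|F a| + B.
Proof.
move=> alpha1 a_t; have t_gt0 : 0 < t by exact: lt_le_trans a_t.
pose r s := `|x s| ^+ 2 * 2^-1; pose r' s := dot (F s) (x s).
have p2 s : 0 < s -> s `^ (alpha *+ 2) = s ^+ 2.
  by move=> s0; rewrite powR_double alpha1 powRr1// ltW.
have Dr s : t0 < s -> is_derive s 1 r (r' s).
  move=> s0; have D := is_derive_sqnorm dotE (strict_derivative_is_derive (xD s0)).
  apply: is_derive_eq (is_derive_mulr D (is_derive_cst (2^-1 : R^o) s (1 : R^o))) _.
  by rewrite mulr0 addr0 /r' /=; field.
have cr s : t0 < s -> r' u @[u --> s] --> r' s.
  move=> s0; apply: (cvg_dot dotE).
    exact: velocity_continuous Mcont t0_gt0 xD _ s0.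
  exact: trajectory_continuous xD _ s0.
have hr s : a <= s <= t ->
    alpha * s `^ (alpha *+ 2 - 2) * dot (x s) (F s) <= r' s.
  by move=> _; rewrite /r' alpha1 mul1r subrr powRr0 mul1r dotC.
have := velocity_energy dotE Mmon t0_gt0 xD at0 a_t Dr cr hr.
rewrite !p2// /r.
have := xB a_t; have := sqr_ge0 (`|x a|); have := normr_ge0 (x t).
move=> h1 h2 h3 h4.
have h5 : `|x t| ^+ 2 <= B ^+ 2 by rewrite ler_sqr ?nnegrE.
have n1 : 0 <= a * `|F a| by rewrite mulr_ge0 ?normr_ge0// ltW.
have n2 : 0 <= t * `|F t| by rewrite mulr_ge0 ?normr_ge0// ltW.
rewrite -ler_sqr ?nnegrE ?addr_ge0// sqrrD.
have n3 : 0 <= a * `|F a| * B by rewrite mulr_ge0.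
rewrite !exprMn mulr2n; lra.
Qed.

(** With [v s = s `^ alpha * |x' s|] and [c] a maximum point of [v] on [a, t],
    the energy inequality on [a, c] bounds [v c ^+ 2] by a quantity linear in
    [v c], hence bounds [v c]. *)
Lemma velocity_rate_neq1 (t : R) : alpha != 1 -> a <= t ->
  exists2 c, a <= c <= t &
  t `^ alpha * `|F t| <= a `^ alpha * `|F a| +
    2 * alpha * B * (c `^ (alpha - 1) - a `^ (alpha - 1)) / (alpha - 1).
Proof.
move=> alpha1 a_t; pose v s := s `^ alpha * `|F s|.
have am1 : alpha - 1 != 0 by rewrite subr_eq0.
have vc : {within `[a, t], continuous v}.
  apply: continuous_in_subspaceT => s; rewrite inE/= in_itv/= => /andP[as_ _].
  apply: cvgM; first by apply: cvg_powR; exact: lt_le_trans as_.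
  by apply: cvg_norm; apply: velocity_continuous Mcont t0_gt0 xD _ _; exact: lt_le_trans as_.
have [c cat vmax] := EVT_max a_t vc.
move: (cat); rewrite in_itv/= => /andP[ac ct].
have va : v a <= v c by apply: vmax; rewrite in_itv/= lexx.
have vt : v t <= v c by apply: vmax; rewrite in_itv/= lexx andbT.
have v0 s : 0 <= v s by rewrite mulr_ge0// powR_ge0.
have [vc0|vc0] := leP (v c) 0.
  exists a; first by rewrite lexx.
  rewrite subrr mulr0 mul0r addr0; apply: le_trans (v0 a); exact: le_trans vc0.
exists c; first by rewrite ac.
apply: (le_trans vt).
pose r s := alpha * B * v c / (alpha - 1) * (s + 0) `^ (alpha - 1).
pose r' s := alpha * B * v c * (s + 0) `^ (alpha - 2).
have Dr s : t0 < s -> is_derive s 1 r (r' s).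
  move=> s0.
  have D := @is_derive_powR_shift R (alpha - 1) 0 s.
  rewrite addr0 in D; have {}D := D (lt_trans t0_gt0 s0).
  pose K : R^o := alpha * B * v c / (alpha - 1).
  apply: is_derive_eq (is_derive_mulr (is_derive_cst K s (1 : R^o)) D) _.
  have -> : alpha - 1 - 1 = alpha - 2 by ring.
  by rewrite /r' /K addr0 /=; field.
have cr s : t0 < s -> r' u @[u --> s] --> r' s.
  move=> s0; apply: cvgM; first exact: cvg_cst.
  rewrite addr0; under eq_fun do rewrite addr0.
  by apply: cvg_powR; exact: lt_trans s0.
have hr s : a <= s <= c ->
    alpha * s `^ (alpha *+ 2 - 2) * dot (x s) (F s) <= r' s.
  move=> /andP[as_ sc]; have s0 : 0 < s by exact: lt_le_trans as_.
  have vs : v s <= v c.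
    by apply: vmax; rewrite in_itv/= as_ (le_trans sc).
  have -> : alpha *+ 2 - 2 = alpha + (alpha - 2) by ring.
  rewrite /r' addr0 powRD ?(gt_eqF s0) ?implybT//.
  have h1 : dot (x s) (F s) <= B * `|F s|.
    apply: le_trans (ler_norm _) _; apply: le_trans (dot_le_norm dotE _ _) _.
    by rewrite ler_wpM2r// xB.
  have w0 := powR_gt0 (alpha - 2) s0; have w1 := powR_gt0 alpha s0.
  apply: (@le_trans _ _ (alpha * s `^ (alpha - 2) * (B * v s))).
    rewrite /v; apply: (@le_trans _ _ (alpha * (s `^ alpha * s `^ (alpha - 2)) * (B * `|F s|))).
      by rewrite ler_pM2l// !mulr_gt0.
    by rewrite le_eqVlt; apply/orP; left; apply/eqP; ring.
  have : alpha * s `^ (alpha - 2) * B * v s <= alpha * s `^ (alpha - 2) * B * v c.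
    by rewrite ler_wpM2l// !mulr_ge0// ltW.
  lra.
have := velocity_energy dotE Mmon t0_gt0 xD at0 ac Dr cr hr.
rewrite /r !addr0 !powR_double -!exprMn -/(v c) -/(v a).
set rc := c `^ _; set ra := a `^ _ => h.
rewrite -(ler_pM2l vc0).
have h2 : v a * v a <= v c * v a by rewrite ler_wpM2r.
have -> : v c * (v a + 2 * alpha * B * (rc - ra) / (alpha - 1)) =
  v c * v a + 2 * (alpha * B * v c / (alpha - 1) * rc - alpha * B * v c / (alpha - 1) * ra).
  by field.
move: h; rewrite !expr2; lra.
Qed.

Lemma velocity_rate : exists2 C, 0 <= C &
  forall t, a <= t -> t `^ Num.min alpha 1 * `|F t| <= C.
Proof.
have va0 : 0 <= a `^ alpha * `|F a| by rewrite mulr_ge0// powR_ge0.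
have wa0 := powR_gt0 (alpha - 1) a_gt0.
have aB : 0 <= 2 * alpha * B by rewrite !mulr_ge0// ltW.
have [a1|a1|a1] := ltgtP alpha 1.
- exists (a `^ alpha * `|F a| + 2 * alpha * B * a `^ (alpha - 1) / (1 - alpha)).
    apply: addr_ge0 => //; apply: divr_ge0; last by rewrite subr_ge0 ltW.
    by rewrite mulr_ge0// ltW.
  move=> t a_t; have [|c /andP[ac ct] h] := velocity_rate_neq1 _ a_t.
    by rewrite lt_eqF.
  apply: le_trans h _; rewrite lerD2l.
  have -> : 2 * alpha * B * (c `^ (alpha - 1) - a `^ (alpha - 1)) / (alpha - 1) =
      2 * alpha * B * (a `^ (alpha - 1) - c `^ (alpha - 1)) / (1 - alpha).
    by field; rewrite !subr_eq0 (lt_eqF a1) (gt_eqF a1).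
  rewrite ler_pM2r ?invr_gt0 ?subr_gt0// ler_wpM2l//.
  by rewrite gerBl powR_ge0.
- exists (a `^ alpha * `|F a| / a `^ (alpha - 1) + 2 * alpha * B / (alpha - 1)).
    by apply: addr_ge0; apply: divr_ge0 => //; rewrite ?subr_ge0 ltW.
  move=> t a_t; have t_gt0 : 0 < t by exact: lt_le_trans a_t.
  have wt0 := powR_gt0 (alpha - 1) t_gt0.
  have am1 : 0 < alpha - 1 by rewrite subr_gt0.
  have mono u v : 0 < u -> u <= v -> u `^ (alpha - 1) <= v `^ (alpha - 1).
    move=> u0 uv; apply: ge0_ler_powR => //; rewrite ?nnegrE ?ltW//.
    exact: lt_le_trans uv.
  have [|c /andP[ac ct] h] := velocity_rate_neq1 _ a_t; first by rewrite gt_eqF.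
  rewrite powRr1; last exact: ltW.
  rewrite -(ler_pM2l wt0) mulrA -powR_pred//.
  apply: le_trans h _; rewrite [leRHS]mulrDr lerD//.
    by rewrite mulrCA ler_peMr// ler_pdivlMr// mul1r mono.
  rewrite mulrA ler_pM2r ?invr_gt0// mulrC ler_wpM2r//.
  have := mono _ _ (lt_le_trans a_gt0 ac) ct; lra.
- exists (a * `|F a| + B); first by rewrite addr_ge0// mulr_ge0// ltW.
  move=> t a_t; rewrite [X in t `^ X]a1 powRr1; last exact: le_trans (ltW a_gt0) a_t.
  exact: velocity_rate_eq1.
Qed.

End Rates.

(** * Weak limits of approximate zeros *)

Section WeakLimits.
Variables (R : realType) (H : completeNormedModType R).
Variables (dot : {dot H for idfun}).
Hypothesis dotE : forall u : H, dot u u = `|u| ^+ 2.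

Lemma sqnormDZ (u v : H) (s : R) :
  `|u + s *: v| ^+ 2 = `|u| ^+ 2 + s * (2 * dot u v) + s * (s * `|v| ^+ 2).
Proof.
rewrite -[s *: v]opprK -scaleNr (dotBB dotE) normrZ exprMn normrN real_normK ?num_real//.
by rewrite linearZr /= /GRing.scale/=; ring.
Qed.

Lemma metric_projection_variational (C : set H) (p z : H) :
  (forall y1 y2 (s : R), C y1 -> C y2 -> 0 <= s <= 1 -> C (y1 + s *: (y2 - y1))) ->
  is_metric_projection C 0 p -> C z -> 0 <= dot p (z - p).
Proof.
move=> Ccvx [Cp pmin] Cz; rewrite leNgt; apply/negP => neg.
(* [s] is small enough for [|p + s *: w|] to be less than [|p|]. *)
set w := z - p in neg *; pose c := - dot p w; have c0 : 0 < c by rewrite oppr_gt0.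
pose n := `|w| ^+ 2; have n0 : 0 <= n by exact: sqr_ge0.
pose s := c / (c + n).
have cn : 0 < c + n by lra.
have s0 : 0 < s by rewrite divr_gt0.
have s1 : s <= 1 by rewrite ler_pdivrMr// mul1r; lra.
have := pmin _ (Ccvx p z s Cp Cz ltac:(by rewrite ltW)).
rewrite !sub0r !normrN -ler_sqr ?nnegrE// -!dotE.
rewrite -/w !dotE sqnormDZ -/n => h.
have {h} : 0 <= s * (s * n - 2 * c) by rewrite /c; lra.
rewrite pmulr_rge0// => h.
have : s * (c + n) = c by rewrite /s divfK// gt_eqF.
nra.
Qed.

Variable M : H -> H.
Hypotheses (Mmon : monotone_operator dot M) (Mcont : continuous M).

(** Minty's lemma: monotonicity is tested on the ray from [z] opposite to
    [M z]. *)
Lemma minty_zero (z : H) : (forall y, 0 <= dot (M y) (y - z)) -> Zer M z.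
Proof.
move=> hz.
have key (s : R) : 0 < s -> `|M z| <= `|M (z - s *: M z) - M z|.
  move=> s0; set w := z - s *: M z.
  have : 0 <= dot (M w) (w - z) by exact: hz.
  have -> : w - z = - (s *: M z) by rewrite /w addrAC subrr add0r.
  rewrite linearNr linearZr /= oppr_ge0 pmulr_rle0// => h3.
  rewrite -ler_sqr ?nnegrE// (dotBB dotE).
  by have := sqr_ge0 (`|M w|); lra.
apply/eqP; rewrite -normr_le0.
have cw : z - s *: M z @[s --> (0:R)^'+] --> z.
  rewrite -[X in _ --> X]subr0 -(scale0r (M z)); apply: cvgB; first exact: cvg_cst.
  by apply: cvgZr_tmp; apply: cvg_at_right_filter; exact: cvg_id.
have cn : `|M (z - s *: M z) - M z| @[s --> (0:R)^'+] --> `|M z - M z|.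
  apply: cvg_norm; apply: cvgB; last exact: cvg_cst.
  by apply: (@cvg_comp _ _ _ _ M _ _ _ cw); exact: Mcont.
rewrite subrr normr0 in cn.
apply: (ler_cvg_to (cvg_cst `|M z|) cn).
by near=> s; apply: key; near: s; exact: nbhs_right_gt.
Unshelve. all: by end_near. Qed.

(** Minty's inequalities relaxed by [e * (|y| + B)]. For [e = 0] and [M]
    continuous and monotone these are the zeros of [M]; for [e > 0] and [M]
    monotone the set contains every [z] such that [|z| <= B] and [|M z| <= e].
    It is closed and convex, and shrinks with [e] when [B >= 0]. *)
Definition approximate_zeros (B e : R) : set H :=
  [set z | forall y, - (e * (`|y| + B)) <= dot (M y) (y - z)].

Lemma closed_approximate_zeros B e : closed (approximate_zeros B e).
Proof.
have -> : approximate_zeros B e =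
   \bigcap_y (fun z => dot (M y) (y - z)) @^-1` [set r | - (e * (`|y| + B)) <= r].
  by apply/seteqP; split=> z h y; [move=> _|]; exact: h.
apply: closed_bigI => y _; apply: preimage_closed; last exact: closed_ge.
move=> z _; apply: (cvg_dot dotE); first exact: cvg_cst.
by apply: cvgB; [exact: cvg_cst|exact: cvg_id].
Qed.

Lemma convex_approximate_zeros B e y1 y2 (s : R) :
  approximate_zeros B e y1 -> approximate_zeros B e y2 -> 0 <= s <= 1 ->
  approximate_zeros B e (y1 + s *: (y2 - y1)).
Proof.
move=> h1 h2 /andP[s0 s1] y; have := h1 y; have := h2 y.
have -> : dot (M y) (y - (y1 + s *: (y2 - y1))) =
   (1 - s) * dot (M y) (y - y1) + s * dot (M y) (y - y2).
  rewrite !(linearDr, linearNr) /= linearZr /= !(linearDr, linearNr) /=; ring.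
move: (dot _ _) (dot _ _) (- _) => p q r; nra.
Qed.

Hypothesis Zer0 : Zer M !=set0.

Let xi := metric_projection (Zer M) 0.
Let xiP : is_metric_projection (Zer M) 0 xi.
Proof. exact: metric_projection_ZerP. Qed.

(** The minimal norm elements of the nested sets of approximate zeros have
    nondecreasing bounded norms, so they form a Cauchy sequence by the
    parallelogram identity; the limit is a zero of [M] of norm at most [|xi|],
    that is, [xi]. This replaces weak compactness. *)
Lemma approximate_zeros_projection_cvg (B : R) : 0 <= B ->
  forall e : R, 0 < e -> exists2 k : R, 0 < k & exists p,
    [/\ is_metric_projection (approximate_zeros B k) 0 p,
        `|xi - p| <= e & `|xi| ^+ 2 - `|p| ^+ 2 <= e].
Proof.
move=> B0; have [Zxi ximin] := xiP.
pose C n := approximate_zeros B n.+1%:R^-1.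
have k0 n : 0 < n.+1%:R^-1 :> R by rewrite invr_gt0.
have Cxi n : C n xi.
  move=> y; have := Mmon y xi; rewrite Zxi subr0; apply: le_trans.
  by rewrite oppr_le0 mulr_ge0 ?addr_ge0// ltW.
have Cmid n u v : C n u -> C n v -> C n (2^-1 *: (u + v)).
  move=> hu hv; have -> : 2^-1 *: (u + v) = u + 2^-1 *: (v - u).
    rewrite scalerDr scalerBr addrCA addrC; congr (_ + _).
    rewrite -{2}[u]scale1r -scalerBl; congr (_ *: _); lra.
  by apply: convex_approximate_zeros => //; rewrite invr_ge0 ler0n invf_le1 ?ler1n.
pose p n := metric_projection (C n) 0.
have pP n : is_metric_projection (C n) 0 (p n).
  apply: (metric_projectionP dotE); first exact: closed_approximate_zeros.
    exact: Cmid.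
  by exists xi.
have Cnest n m : (n <= m)%N -> C m `<=` C n.
  move=> nm z hz y; apply: le_trans (hz y); rewrite lerN2 ler_wpM2r ?addr_ge0//.
  by rewrite lef_pV2 ?posrE// ler_nat ltnS.
have pmin n z : C n z -> `|p n| ^+ 2 <= `|z| ^+ 2.
  move=> Cz; have := (pP n).2 _ Cz; rewrite !sub0r !normrN => h.
  by rewrite ler_sqr ?nnegrE.
have dist n m : (n <= m)%N -> `|p n - p m| ^+ 2 <= 2 * `|p m| ^+ 2 - 2 * `|p n| ^+ 2.
  move=> nm; rewrite (dot_parallelogram dotE).
  have := pmin _ _ (Cmid n _ _ (pP n).1 (Cnest _ _ nm _ (pP m).1)).
  rewrite normrZ exprMn ger0_norm ?invr_ge0// expr2 => h; lra.
have nd : nondecreasing_seq (fun n => `|p n| ^+ 2).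
  by move=> n m nm; apply: pmin; exact: Cnest nm _ (pP m).1.
have sc : cvgn (fun n => `|p n| ^+ 2).
  apply: nondecreasing_is_cvgn => //; exists (`|xi| ^+ 2) => _ [n _ <-].
  exact: pmin.
have cp : cvgn p.
  apply/cauchy_cvgP/cauchyP => e e0.
  have e20 : 0 < e ^+ 2 / 4 by rewrite divr_gt0// exprn_gt0.
  have /cvgrPdist_lt/(_ _ e20) [N _ NP] := sc.
  exists (p N); exists N => // n /= Nn; rewrite -ball_normE /=.
  rewrite -ltr_sqr ?nnegrE ?(ltW e0)//; apply: le_lt_trans (dist _ _ Nn) _.
  have := NP N (leqnn _); have := NP n Nn; rewrite /= !ltr_norml.
  by move=> /andP[h1 h2] /andP[h3 h4]; lra.
have Cq n : C n (limn p).
  apply: (closed_cvg _ (@closed_approximate_zeros B n.+1%:R^-1) _ _ cp).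
  by exists n => // m /= nm; exact: Cnest nm _ (pP m).1.
have np : `|p n| ^+ 2 @[n --> \oo] --> `|limn p| ^+ 2.
  rewrite expr2; under eq_fun do rewrite expr2.
  by apply: cvgM; apply: cvg_norm; exact: cp.
have qxi : `|limn p| <= `|xi|.
  rewrite -ler_sqr ?nnegrE//; apply: (ler_cvg_to np (cvg_cst (`|xi| ^+ 2))).
  by apply: nearW => n; exact: pmin.
have Zq : Zer M (limn p).
  apply: minty_zero => y.
  have c0 : - (n.+1%:R^-1 * (`|y| + B)) @[n --> \oo] --> - (0 * (`|y| + B)).
    by apply: cvgN; apply: cvgM; [exact: cvg_harmonic|exact: cvg_cst].
  rewrite mul0r oppr0 in c0.
  apply: (ler_cvg_to c0 (cvg_cst (dot (M y) (y - limn p)))).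
  by apply: nearW => n; exact: Cq.
have qE : limn p = xi.
  apply: (metric_projection_unique dotE (Zer_midpoint dotE Mmon Mcont)) xiP.
  split=> // y /ximin; apply: le_trans; by rewrite !sub0r !normrN.
rewrite qE in np; have cp' : p n @[n --> \oo] --> xi by rewrite -qE.
move=> e e0.
have /cvgrPdist_le/(_ _ e0) [N1 _ N1P] := cp'.
have /cvgrPdist_le/(_ _ e0) [N2 _ N2P] := np.
pose N := maxn N1 N2.
exists (N.+1%:R^-1) => //; exists (p N); split; first exact: pP.
  exact: (N1P N (leq_maxl _ _)).
apply: le_trans (ler_norm _) _; exact: (N2P N (leq_maxr _ _)).
Qed.

(** Along a bounded family with [M x] tending to 0, every weak cluster point is
    a zero of [M]; this is the resulting lower bound on [<xi, x - xi>]. *)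
Lemma weak_liminf_projection T (G : set_system T) {FG : Filter G} (x : T -> H)
    (B : R) : 0 <= B ->
  (\forall t \near G, `|x t| <= B) -> M (x t) @[t --> G] --> (0 : H) ->
  forall e, 0 < e -> \forall t \near G, - e <= dot xi (x t - xi).
Proof.
move=> B0 xB Mx0 e e0.
pose e1 := e / (B + 1); have B1 : 0 < B + 1 by lra.
have e10 : 0 < e1 by rewrite divr_gt0.
have ee1 : e1 * B + e1 = e by rewrite -[X in _ + X]mulr1 -mulrDr /e1 divfK// gt_eqF.
have [k k0 [p [pP xip nxip]]] := approximate_zeros_projection_cvg B0 e10.
have Mk : \forall t \near G, `|M (x t)| <= k.
  by move/cvgr_norm_le : Mx0; apply; rewrite normr0.
near=> t.
have xt : `|x t| <= B by near: t.
have Mt : `|M (x t)| <= k by near: t.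
have Cx : approximate_zeros B k (x t).
  move=> y; have := Mmon y (x t); rewrite linearBl /= => h.
  have : `|dot (M (x t)) (y - x t)| <= k * (`|y| + B).
    apply: le_trans (dot_le_norm dotE _ _) _; apply: ler_pM => //.
    by apply: le_trans (ler_normB _ _) _; rewrite lerD2l.
  rewrite ler_norml => /andP[h1 h2]; lra.
have := metric_projection_variational (@convex_approximate_zeros B k) pP Cx.
have -> : dot xi (x t - xi) = dot p (x t - p) + dot (xi - p) (x t) - 
   (`|xi| ^+ 2 - `|p| ^+ 2).
  by rewrite -!dotE !(linearBr, linearBl) /=; ring.
have : `|dot (xi - p) (x t)| <= e1 * B.
  by apply: le_trans (dot_le_norm dotE _ _) _; exact: ler_pM.
rewrite ler_norml => /andP[h1 h2]; lra.
Unshelve. all: by end_near. Qed.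

End WeakLimits.

(** * Strong solutions and strong convergence *)

Lemma powR_near_pinfty (R : realType) (K r : R) : 0 < r ->
  \forall t \near +oo, K <= t `^ r.
Proof.
move=> r0; exists (Num.max 0 K `^ r^-1); split; first exact: num_real.
move=> t /ltW Kt; have K0 : 0 <= Num.max 0 K by rewrite le_max lexx.
apply: (@le_trans _ _ (Num.max 0 K)); first by rewrite le_max lexx orbT.
rewrite -[leLHS]powRr1// -[X in _ `^ X](@mulVf _ r) ?gt_eqF// powRrM.
apply: ge0_ler_powR => //; rewrite ?nnegrE ?powR_ge0//; first exact: ltW.
exact: le_trans (powR_ge0 _ _) Kt.
Qed.

(** A strong solution satisfies the equation at every [t > t0], with a strict
    derivative. *)
Lemma strong_solution_strict_derivative (R : realType) (H : normedModType R)
    (M : H -> H) (alpha t0 : R) (x0 : H) (x : R -> H) :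
  continuous M -> 0 < t0 -> strong_global_solution M alpha t0 x0 x ->
  forall t, t0 < t -> strict_derivative x t (velocity M alpha x t).
Proof.
move=> Mcont t0_gt0 [xac _ xae _] t tt0.
have xac1 : absolutely_continuous_on t0 (t + 1) x by apply: xac; lra.
apply: (@ae_strict_derivative _ _ x (velocity M alpha x) t0 (t + 1)) => //.
- by rewrite tt0; lra.
- apply: (@filterS _ _ (ae_filter_ringOfSetsType _) _ _ _ xae) => s sE /andP[/sE[xs Ds] _].
  split=> //; apply/eqP; rewrite -subr_eq0 /velocity opprB opprK; apply/eqP.
  by rewrite -[RHS]Ds -addrA; congr (_ + _); rewrite addrC.
apply: velocity_cvg => //; first by rewrite gt_eqF// (lt_trans t0_gt0).
apply/cvgrPdist_lt => e e0.
have [d d0 dP] := absolutely_continuous_on_uniform xac1 e0.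
near=> s.
have sd : `|t - s| < d by near: s; apply: cvgr_dist_lt; [exact: cvg_id|].
have s1 : s < t + 1 by near: s; apply: lt_nbhsl; lra.
have s0 : t0 < s by near: s; exact: lt_nbhsr.
move: sd; have [st|ts] := leP s t.
  rewrite ger0_norm ?subr_ge0// => sd; apply: dP => //; lra.
rewrite ltr0_norm ?subr_lt0// opprB distrC => sd; apply: dP => //; lra.
Unshelve. all: by end_near. Qed.

Section Convergence.
Variables (R : realType) (H : completeNormedModType R).
Variables (dot : {dot H for idfun}).
Hypothesis dotE : forall u : H, dot u u = `|u| ^+ 2.
Variables (M : H -> H) (alpha t0 : R) (x : R -> H).
Hypotheses (Mmon : monotone_operator dot M) (Mcont : continuous M).
Hypothesis Zer0 : Zer M !=set0.
Hypotheses (t0_gt0 : 0 < t0) (alpha_gt0 : 0 < alpha).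
Local Notation F := (velocity M alpha x).
Hypothesis xD : forall t, t0 < t -> strict_derivative x t (F t).

Lemma weighted_dist_le (xi : H) (e a t : R) : t0 < a -> Zer M xi ->
  (forall s, a <= s -> - e <= dot xi (x s - xi)) -> a <= t ->
  t `^ (alpha *+ 2) * (`|x t - xi| ^+ 2 - e) <=
  a `^ (alpha *+ 2) * (`|x a - xi| ^+ 2 - e).
Proof.
move=> at0 Mxi he a_t; have a_gt0 : 0 < a by exact: lt_trans at0.
have dG s : a <= s <= t -> is_derive s 1
    (fun s => (s + 0) `^ (alpha *+ 2) * (`|x s - xi| ^+ 2 - e))
    (alpha *+ 2 * (s + 0) `^ (alpha *+ 2 - 1) * (`|x s - xi| ^+ 2 - e) +
     (s + 0) `^ (alpha *+ 2) * (2 * dot (F s) (x s - xi) - 0)).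
  move=> /andP[as_ _]; apply: is_derive_mulr.
    by apply: is_derive_powR_shift; rewrite addr0 (lt_le_trans a_gt0).
  have Ds := is_derive_dist dotE xD xi (lt_le_trans at0 as_).
  exact: is_deriveB Ds (is_derive_cst _ _ _).
have gle0 s : a <= s <= t ->
    alpha *+ 2 * (s + 0) `^ (alpha *+ 2 - 1) * (`|x s - xi| ^+ 2 - e) +
     (s + 0) `^ (alpha *+ 2) * (2 * dot (F s) (x s - xi) - 0) <= 0.
  move=> /andP[as_ _]; have s0 : 0 < s by exact: lt_le_trans as_.
  rewrite addr0 subr0 (powR_pred (alpha *+ 2) s0).
  have := velocity_dot_le alpha x Mmon s Mxi.
  have -> : dot (x s) (x s - xi) = `|x s - xi| ^+ 2 + dot xi (x s - xi).
    by rewrite -dotE -linearDl /= subrK.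
  have := he _ as_; have := powR_gt0 (alpha *+ 2 - 1) s0.
  move: (s `^ _) (dot (F s) _) (dot xi _) => w p q.
  move: (`|x s - xi| ^+ 2) => X w0 qe pq.
  have h : p * s <= - alpha * (X + q).
    have -> : - alpha * (X + q) = - (alpha / s * (X + q)) * s.
      by field; rewrite gt_eqF.
    by rewrite ler_pM2r.
  have -> : alpha *+ 2 * w * (X - e) + w * s * (2 * p) =
     w * 2 * (alpha * (X - e) + p * s) by ring.
  rewrite pmulr_rle0 ?mulr_gt0//.
  have : 0 <= alpha * (q + e) by apply: mulr_ge0; [exact: ltW|lra].
  lra.
have := is_derive_increment_le a_t dG gle0.
by rewrite !addr0 mul0r subr_le0.
Qed.

Lemma trajectory_strong_cvg : M (x t) @[t --> +oo] --> (0 : H) ->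
  (exists B, 0 <= B /\ \forall t \near +oo, `|x t| <= B) ->
  x t @[t --> +oo] --> metric_projection (Zer M) 0.
Proof.
move=> Mx0 [B [B0 xB]]; set xi := metric_projection _ _.
have [Zxi _] : is_metric_projection (Zer M) 0 xi by exact: metric_projection_ZerP.
apply/cvgrPdist_lt => e e0; pose k := e ^+ 2 / 4.
have k0 : 0 < k by rewrite divr_gt0 ?exprn_gt0.
have [T [_ hT]] := weak_liminf_projection dotE Mmon Mcont Zer0 B0 xB Mx0 k0.
pose a := Num.max T t0 + 1.
have aT : T < a by rewrite ltr_pwDr// le_max lexx.
have at0 : t0 < a by rewrite ltr_pwDr// le_max lexx orbT.
pose K := a `^ (alpha *+ 2) * (`|x a - xi| ^+ 2 - k).
near=> t.
have a_t : a <= t by near: t; apply: nbhs_pinfty_ge; exact: num_real.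
have t0_ : 0 < t by apply: lt_le_trans a_t; exact: lt_trans at0.
have Kt : K / k <= t `^ (alpha *+ 2).
  by near: t; apply: powR_near_pinfty; rewrite mulr2n addr_gt0.
have hs s : a <= s -> - k <= dot xi (x s - xi).
  by move=> as_; apply: hT; exact: lt_le_trans as_.
have := weighted_dist_le at0 Zxi hs a_t; rewrite -/K => h.
rewrite distrC -ltr_sqr ?nnegrE ?(ltW e0)//.
have w0 := powR_gt0 (alpha *+ 2) t0_.
have : t `^ (alpha *+ 2) * (`|x t - xi| ^+ 2 - k) <= t `^ (alpha *+ 2) * k.
  by apply: le_trans h _; rewrite -ler_pdivrMr.
rewrite ler_pM2l// => {}h; have : k * 4 = e ^+ 2 by rewrite /k divfK.
lra.
Unshelve. all: by end_near. Qed.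

End Convergence.

Theorem corollary2p10 (R : realType) (H : completeNormedModType R)
    (dot : {dot H for idfun}) (dotE : forall u : H, dot u u = `|u| ^+ 2)
    (M : H -> H) (Mmon : monotone_operator dot M) (Mcont : continuous M)
    (Zer0 : Zer M !=set0)
    (t0 alpha : R) (t0_gt0 : 0 < t0) (alpha_gt0 : 0 < alpha)
    (x0 : H) (x : R -> H) (xsol : trajectory_solution M alpha t0 x0 x) :
  ('D_1 x =O_ (ae_pinfty R) (fun t : R => (t `^ Num.min alpha 1)^-1) /\
   (fun t => M (x t)) =O_ (pinfty_nbhs R)
     (fun t : R => (t `^ Num.min alpha 1)^-1)) /\
  x t @[t --> +oo] --> metric_projection (Zer M) 0.
Proof.
have xD := strong_solution_strict_derivative Mcont t0_gt0 xsol.1.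
have [xi Zxi] := Zer0.
(* Starting at [t0 + 1 >= 1] ensures [t `^ m <= t]. *)
pose a := t0 + 1; have at0 : t0 < a by rewrite ltrDl.
have a_gt0 : 0 < a by exact: lt_trans at0.
have [B B0 xB] := trajectory_bounded dotE Mmon t0_gt0 alpha_gt0 xD at0 Zxi.
have [C C0 FC] := velocity_rate dotE Mmon Mcont t0_gt0 alpha_gt0 xD at0 B0 xB.
have a_ge1 : 1 <= a by rewrite lerDr ltW.
pose m := Num.min alpha 1.
have m0 : 0 < m by rewrite lt_min alpha_gt0/=.
have MC t : a <= t -> t `^ m * `|M (x t)| <= C + alpha * B.
  move=> a_t; have t_gt0 : 0 < t by exact: lt_le_trans a_t.
  have -> : M (x t) = - (velocity M alpha x t) - (alpha / t) *: x t.
    by rewrite /velocity opprB opprK addrAC subrr add0r.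
  apply: (@le_trans _ _ (t `^ m * (`|velocity M alpha x t| + `|(alpha / t) *: x t|))).
    rewrite ler_wpM2l ?powR_ge0// -[`|velocity _ _ _ _|]normrN.
    exact: ler_normB.
  rewrite mulrDr lerD ?FC// normrZ ger0_norm; last by rewrite divr_ge0// ltW.
  have tm : t `^ m <= t.
    rewrite -[leRHS]powRr1; last exact: ltW.
    by apply: ler_powR; [exact: le_trans a_ge1 a_t|rewrite ge_min lexx orbT].
  have := xB _ a_t; have := normr_ge0 (x t); move: (`|x t|) => X X0 XB.
  have -> : t `^ m * (alpha / t * X) = (t `^ m / t) * (alpha * X) by ring.
  apply: (@le_trans _ _ (alpha * X)); last by rewrite ler_pM2l.
  apply: ler_piMl; first by rewrite mulr_ge0// ltW.
  by rewrite ler_pdivrMr// mul1r.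
have rate (K t : R) (z : H) : a <= t -> t `^ m * `|z| <= K -> 
    `|z| <= (K + 1) * `|(t `^ m)^-1|.
  move=> a_t h; have w0 : 0 < t `^ m by apply: powR_gt0; exact: lt_le_trans a_t.
  rewrite ger0_norm ?invr_ge0 ?(ltW w0)// ler_pdivlMr// mulrC; lra.
have MC0 : 0 <= C + alpha * B by rewrite addr_ge0// mulr_ge0// ltW.
have MO : \forall t \near +oo, `|M (x t)| <= (C + alpha * B + 1) * `|(t `^ m)^-1|.
  near=> t; have a_t : a <= t by near: t; apply: nbhs_pinfty_ge; exact: num_real.
  by apply: rate => //; exact: MC.
split; first split.
- apply/eqO_exP; exists (C + 1); first by lra.
  exists a; apply: aeW => t a_t.
  have [_ ->] := strict_derivative_is_derive (xD _ (lt_le_trans at0 a_t)).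
  exact: (rate _ _ _ a_t (FC _ a_t)).
- by apply/eqO_exP; exists (C + alpha * B + 1); first lra.
apply: (trajectory_strong_cvg dotE Mmon Mcont Zer0 t0_gt0 alpha_gt0 xD).
  apply/cvgrPdist_le => e e0; near=> t.
  have a_t : a <= t by near: t; apply: nbhs_pinfty_ge; exact: num_real.
  rewrite sub0r normrN.
  have : (C + alpha * B + 1) / e <= t `^ m by near: t; exact: powR_near_pinfty.
  have : `|M (x t)| <= (C + alpha * B + 1) * `|(t `^ m)^-1| by near: t.
  have w0 : 0 < t `^ m by apply: powR_gt0; exact: lt_le_trans a_t.
  rewrite [`|_^-1|]ger0_norm ?invr_ge0 ?(ltW w0)// => h.
  rewrite ler_pdivrMr// => h2; apply: le_trans h _.
  by rewrite ler_pdivrMr// [leRHS]mulrC.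
exists B; split=> //; near=> t; apply: xB; near: t; apply: nbhs_pinfty_ge; exact: num_real.
Unshelve. all: by end_near. Qed.
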